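(* Let $X_1,X_2,\ldots$ and $Y_1,Y_2,\ldots$ be mutually independent real random variables on a probability space $(\Omega,\mathfrak{A},P)$, where each $X_i$ has distribution function $F_0$ and each $Y_i$ has distribution function $F_1$. Suppose $F_0$ and $F_1$ are differentiable on $\mathbb{R}$ with continuous derivatives $f_0$ and $f_1$, respectively, that the set $C'(f_0,f_1)$ of coincidence points is finite, and that the set $C(f_0,f_1)$ of crossover points has cardinality $N<\infty$. Let $\rho=\int_{-\infty}^{\infty}\min\{f_0(x),f_1(x)\}\,dx$. Then $\rho_{N,m,n}$ converges almost surely to $\rho$ as $m,n\to\infty$, i.e. $P(\{\omega\in\Omega:\lim_{m,n\to\infty}\rho_{N,m,n}(\omega)=\rho\})=1$.
   Context: $C'(f_0,f_1)=\{x\in\mathbb{R}: f_0(x)=f_1(x)\}$ (coincidence points). $C(f_0,f_1)$ (crossover points) is the set of $x\in\mathbb{R}$ with $f_0(x)=f_1(x)$ for which there is a neighborhood $V$ of $x$ such that for all $a,b\in V$: $(a-x)(b-x)>0$ if and only if $[f_0(a)-f_1(a)][f_0(b)-f_1(b)]>0$. (Under the hypotheses $N\ge 1$ automatically.) Empirical distribution functions: $F_{0,m}(x)=\frac1m\#\{i\le m: X_i\le x\}$, $F_{1,n}(x)=\frac1n\#\{i\le n: Y_i\le x\}$ for $x\in\mathbb{R}$; $F_{0,m}(\infty)=F_{1,n}(\infty)=1$ and $F_{0,m}(-\infty)=F_{1,n}(-\infty)=0$. For a function $g$ write $g|_x^y=g(y)-g(x)$. For a positive integer $q$ let $\mathbb{R}^q_\le=\{(v_1,\ldots,v_q)\in\mathbb{R}^q: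 v_1\le\cdots\le v_q\}$. For $\boldsymbol{v}=(v_1,\ldots,v_q)\in\mathbb{R}^q_\le$, with $v_0=-\infty$, $v_{q+1}=\infty$, put $$r_{m,n}(\boldsymbol{v})=\sum_{i=0}^q\min\{F_{0,m}|_{v_i}^{v_{i+1}},F_{1,n}|_{v_i}^{v_{i+1}}\},\qquad \rho_{q,m,n}=\min_{\boldsymbol{v}\in\mathbb{R}^q_\le}r_{m,n}(\boldsymbol{v}),$$ where the minimum exists because $r_{m,n}$ takes finitely many values. The double limit $m,n\to\infty$ means that $m$ and $n$ both tend to infinity (for every $\epsilon>0$ there is $M$ such that the difference is $<\epsilon$ for all $m,n\ge M$). *)

(* Defs.v *)
From HB Require Import structures.
From mathcomp Require Import all_boot all_order all_algebra finmap.
From mathcomp Require Import all_classical all_reals all_analysis.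

Set Implicit Arguments.
Unset Strict Implicit.
Unset Printing Implicit Defensive.

Import Order.TTheory GRing.Theory Num.Theory.
Import numFieldNormedType.Exports.

Local Open Scope classical_set_scope.
Local Open Scope ring_scope.

Definition mutually_independent (d : measure_display) (T : measurableType d)
    (R : realType) (P : probability T R) (I : choiceType)
    (Z : I -> {RV P >-> R}) : Prop :=
  forall (J : {fset I}) (A : I -> set R), (forall i, measurable (A i)) ->
  P (\bigcap_(i in [set` J]) (Z i @^-1` A i)) =
    (\prod_(i <- J) P (Z i @^-1` A i))%E.

(* The two sequences merged into one family, so that independence can be
   required of all the [X i] and [Y j] together. *)
Definition joint_family (d : measure_display) (T : measurableType d)
    (R : realType) (P : probability T R) (X Y : nat -> {RV P >-> R})
    (k : nat + nat) : {RV P >-> R} :=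
  match k with inl i => X i | inr j => Y j end.

Section crossover.
Context {R : realType}.

Definition coincidence_points (f0 f1 : R -> R) : set R := [set x | f0 x = f1 x].

Definition crossover_points (f0 f1 : R -> R) : set R :=
  [set x | f0 x = f1 x /\
    exists2 V : set R, nbhs x V &
      forall a b : R, V a -> V b ->
        (0 < (a - x) * (b - x) <-> 0 < (f0 a - f1 a) * (f0 b - f1 b))].

End crossover.

Section empirical.
Context {R : realType}.
Implicit Types (x y : nat -> R) (m n q : nat).

(* Empirical distribution function of [x 0, ..., x m.-1], extended to the
   infinite points by convention (which only matters for [m = 0]). *)
Definition ecdf x m (t : \bar R) : R :=
  match t with
  | r%:E => #|[pred i : 'I_m | x i <= r]|%:R / m%:R
  | +oo%E => 1
  | -oo%E => 0
  end.

Definition nondecreasing_tuples q : set (q.-tuple R) :=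
  [set v | sorted <=%R v].
Arguments nondecreasing_tuples : clear implicits.

(* [v_0 = -oo], [v_1, ..., v_q] are the entries of [v], [v_(q+1) = +oo]. *)
Definition cutpoint q (v : q.-tuple R) (i : nat) : \bar R :=
  nth +oo%E (-oo%E :: map EFin v) i.

Definition empirical_overlap x y m n q (v : q.-tuple R) : R :=
  \sum_(i < q.+1)
    Num.min (ecdf x m (cutpoint v i.+1) - ecdf x m (cutpoint v i))
            (ecdf y n (cutpoint v i.+1) - ecdf y n (cutpoint v i)).

(* The infimum is attained, see [min_overlap_attained]. *)
Definition min_overlap x y q m n : R :=
  inf [set empirical_overlap x y m n v | v in nondecreasing_tuples q].

Lemma finite_range_ecdf x m : finite_set (range (ecdf x m)).
Proof.
apply: (@sub_finite_set _ _
  ([set k%:R / m%:R | k in `I_m.+1] `|` [set 0; 1])).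
  move=> _ [[r| |] _ <-] /=; [left|by right; right|by right; left].
  exists #|[pred i : 'I_m | x i <= r]| => //=.
  by rewrite ltnS -[leqRHS]card_ord max_card.
rewrite finite_setU; split; last exact: finite_set2.
exact/finite_image/finite_II.
Qed.

Lemma finite_overlaps x y q m n :
  finite_set [set empirical_overlap x y m n v | v in nondecreasing_tuples q].
Proof.
pose A := fset_set (range (ecdf x m)); pose B := fset_set (range (ecdf y n)).
have Ax t : ecdf x m t \in A.
  by rewrite in_fset_set ?inE; [exists t|exact: finite_range_ecdf].
have By t : ecdf y n t \in B.
  by rewrite in_fset_set ?inE; [exists t|exact: finite_range_ecdf].
pose G (g : {ffun 'I_q.+2 -> A * B}) : R := \sum_(i < q.+1)
  Num.min (val (g (lift ord0 i)).1 - val (g (widen_ord (leqnSn _) i)).1)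
          (val (g (lift ord0 i)).2 - val (g (widen_ord (leqnSn _) i)).2).
apply: (@sub_finite_set _ _ (G @` setT)); last exact/finite_image/finite_finset.
move=> _ [v _ <-].
exists [ffun i : 'I_q.+2 =>
  ([` Ax (cutpoint v i)]%fset, [` By (cutpoint v i)]%fset)] => //.
by apply: eq_bigr => i _; rewrite !ffunE.
Qed.

Lemma finite_inf_min (A : set R) :
  finite_set A -> A !=set0 -> A (inf A) /\ lbound A (inf A).
Proof.
move=> Afin [a Aa].
have aA : a \in fset_set A by rewrite in_fset_set ?inE.
pose b := [arg min_(i < [` aA]%fset) val i]%O.
have bmin : lbound A (val b).
  move=> c Ac; have cA : c \in fset_set A by rewrite in_fset_set ?inE.
  by rewrite /b; case: Order.TotalTheory.arg_minP => // i _ /(_ [` cA]%fset isT).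
have Ab : A (val b) by have := valP b; rewrite in_fset_set ?inE.
suff -> : inf A = val b by [].
apply/eqP; rewrite eq_le; apply/andP; split.
- by apply: ge_inf => //; exists (val b).
- by apply: lb_le_inf; [exists a|].
Qed.

Lemma min_overlap_attained x y q m n :
  (exists2 v : q.-tuple R, nondecreasing_tuples q v &
     empirical_overlap x y m n v = min_overlap x y q m n) /\
  (forall v : q.-tuple R, nondecreasing_tuples q v ->
     min_overlap x y q m n <= empirical_overlap x y m n v).
Proof.
have fin := finite_overlaps x y q m n.
have v0 : nondecreasing_tuples q [tuple of nseq q 0].
  by rewrite /nondecreasing_tuples /=; elim: q {fin} => // -[|q] //= ->; rewrite lexx.
have [|inf_in inf_lb] := finite_inf_min fin.
  by exists (empirical_overlap x y m n [tuple of nseq q 0]), [tuple of nseq q 0].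
by split=> // v vs; apply: inf_lb; exists v.
Qed.

End empirical.

(* Main.v *)
(** By Glivenko-Cantelli, both empirical distribution functions are almost
    surely eventually uniformly e-close to F0 and F1, so the empirical overlap
    is within 2(N+1)e of the overlap r(v) computed from F0 and F1, uniformly in
    the cut points v.  On each cell, min(int f0, int f1) >= int min(f0, f1), so
    r(v) >= rho for every v; equality holds when v lists the crossover points,
    because f0 - f1 does not change sign between two consecutive ones.  The
    strong law for indicators follows from the second moment: along squares the
    squared deviations have a summable mean, and monotonicity of the counts
    fills the gaps between squares. *)

Require Import Defs.
From mathcomp Require Import all_boot all_order all_algebra finmap.
From mathcomp Require Import all_classical all_reals all_analysis.
From mathcomp Require Import measurable_realfun.
From mathcomp Require Import lra ring.

Import Order.TTheory GRing.Theory Num.Theory.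
Import numFieldNormedType.Exports.
Local Open Scope classical_set_scope.
Local Open Scope ring_scope.

(** * Densities on the half-lines *)

Definition ext_cdf {R : realType} (F : R -> R) (t : \bar R) : R :=
  match t with
  | r%:E => F r
  | +oo%E => 1
  | -oo%E => 0
  end.

(** An extended endpoint makes every cell between consecutive cut points, unbounded ones included, a
    difference of two such sets. *)
Definition lower_set {R : realType} (t : \bar R) : set R :=
  [set x : R | (x%:E <= t)%E].

Lemma lower_setNy {R : realType} : lower_set (-oo%E : \bar R) = set0.
Proof. by rewrite -subset0 => x; rewrite /lower_set/= leeNy_eq. Qed.

Lemma lower_sety {R : realType} : lower_set (+oo%E : \bar R) = setT.
Proof. by rewrite -subTset => x _; rewrite /lower_set/= leey. Qed.

Lemma lower_set_fin {R : realType} (r : R) : lower_set r%:E = `]-oo, r]%classic.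
Proof. by apply/seteqP; split=> x; rewrite /lower_set/= in_itv. Qed.

Lemma measurable_lower_set {R : realType} (t : \bar R) :
  measurable (lower_set t).
Proof.
by case: t => [r| |]; rewrite ?lower_set_fin ?lower_sety ?lower_setNy.
Qed.

Lemma subset_lower_set {R : realType} (s t : \bar R) :
  (s <= t)%E -> lower_set s `<=` lower_set t.
Proof. by move=> st x /le_trans; exact. Qed.

(** Adding the slope [e] makes [F] strictly increasing, so [0 <= f x + e] for every [e > 0]. *)
Lemma derive_nondecreasing_ge0 {R : realType} (F f : R -> R) :
  {homo F : x y / x <= y} -> (forall x : R, is_derive x (1 : R) F (f x)) ->
  forall x, 0 <= f x.
Proof.
move=> Fnd dF x; apply/ler_addgt0Pr => e e0.
pose G y : R := F y + e * y.
have dG y : is_derive y (1 : R) G (f y + e).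
  have -> : G = F \+ (e \*o id) by [].
  by apply: is_derive_eq; rewrite /GRing.scale/= mulr1.
have /(_ x) := @incr_derive1_ge0 _ G setT.
rewrite interiorT derive1E derive_val addrC; apply=> //.
move=> y z _ _ yz; rewrite /G ler_ltD ?ltr_pM2l//.
exact/Fnd/ltW.
Qed.

Section density.
Context {R : realType} (F f : R -> R).
Hypotheses (Fnd : {homo F : x y / x <= y})
  (Fy : F x @[x --> +oo] --> (1 : R)) (FNy : F x @[x --> -oo] --> (0 : R))
  (dF : forall x : R, is_derive x (1 : R) F (f x)) (cf : continuous f).
Local Notation mu := lebesgue_measure.

Let f_ge0 := @derive_nondecreasing_ge0 R F f Fnd dF.

Lemma derivable_cdf x : derivable F x 1.
Proof. exact: (@ex_derive _ _ _ _ _ _ _ (dF x)). Qed.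

Lemma continuous_cdf : continuous F.
Proof.
by move=> x; apply/differentiable_continuous/derivable1_diffP/derivable_cdf.
Qed.

(** The reflection [x |-> - x] moves the integral to [[- r, +oo[], where [- F (- y)] is an
    antiderivative that tends to 0 at infinity. *)
Lemma integral_density_lower_tail r :
  (\int[mu]_(x in `]-oo, r]) (f x)%:E = (F r)%:E)%E.
Proof.
rewrite -[r]opprK ge0_integration_by_substitutionNy; first last.
- by move=> x _; exact: f_ge0.
- exact: continuous_subspaceT.
have dFN x : is_derive x (1 : R) (fun y => - F (- y)) (f (- x)).
  have dFx := dF (- x).
  have dN : is_derive x (1 : R) (-%R : R -> R) (- 1) by apply: is_deriveNid.
  have := @is_derive1_comp R F -%R x (f (- x)) (-1) dFx dN.
  move=> d; have := is_deriveN d.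
  by rewrite /GRing.scale/= mulrN1 opprK.
rewrite (@ge0_continuous_FTC2y _ (f \o -%R) (fun y => - F (- y)) _ 0).
- by rewrite sub0e EFinN oppeK.
- by move=> x _; exact: f_ge0.
- apply: continuous_subspaceT => x; apply: continuous_comp; last exact: cf.
  exact: opp_continuous.
- rewrite -[X in _ --> X]oppr0; apply: cvgN.
  by move/cvgNy_compNP : FNy.
- by move=> x _; exact: (@ex_derive _ _ _ _ _ _ _ (dFN x)).
- apply: cvg_at_right_filter.
  suff : {for - r, continuous (fun y => - F (- y))} by [].
  apply/differentiable_continuous/derivable1_diffP.
  exact: (@ex_derive _ _ _ _ _ _ _ (dFN _)).
- by move=> x _; rewrite derive1E derive_val.
Qed.

(** Cutting at 0, the lower tail contributes [F 0] and the fundamental theorem gives [1 - F 0] for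
    the upper one. *)
Lemma integral_densityT : (\int[mu]_x (f x)%:E = 1)%E.
Proof.
have -> : setT = `]-oo, 0%R] `|` `]0%R, +oo[ :> set R.
  apply/esym; rewrite -subTset => x _ /=; rewrite !in_itv/= andbT.
  by have [|] := leP x 0; [left|right].
have mf (D : set R) : measurable D -> measurable_fun D f.
  move=> mD; apply/measurable_funTS.
  exact: continuous_measurable_fun.
rewrite ge0_integral_setU//=; first last.
- rewrite disj_set2E; apply/eqP; rewrite -subset0 => x [] /=.
  by rewrite !in_itv/= andbT => /le_lt_trans /[apply]; rewrite ltxx.
- by move=> x _; rewrite lee_fin.
- apply/measurable_EFinP; apply: mf.
  exact: (measurableU _ _ (measurable_itv _) (measurable_itv _)).
rewrite integral_density_lower_tail integral_itv_obnd_cbnd; last first.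
  apply/measurable_EFinP; apply: mf; exact: measurable_itv.
rewrite (@ge0_continuous_FTC2y _ f F _ 1) //.
- by rewrite addeC subeK.
- exact: continuous_subspaceT.
- exact/cvg_at_right_filter/continuous_cdf.
- by move=> x _; rewrite derive1E derive_val.
Qed.

Lemma integral_density_lower_set (t : \bar R) :
  (\int[mu]_(x in lower_set t) (f x)%:E = (ext_cdf F t)%:E)%E.
Proof.
case: t => [r| |] /=.
- by rewrite lower_set_fin integral_density_lower_tail.
- by rewrite lower_sety integral_densityT.
- by rewrite lower_setNy integral_set0.
Qed.

Lemma integrable_density : mu.-integrable setT (EFin \o f).
Proof.
apply/integrableP; split.
  by apply/measurable_EFinP; exact: continuous_measurable_fun.
under eq_integral do rewrite gee0_abs ?lee_fin ?f_ge0//.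
by rewrite integral_densityT ltry.
Qed.

End density.

(** * Sign changes and crossover points *)

Lemma crossover_pointsC {R : realType} (f0 f1 : R -> R) :
  crossover_points f0 f1 = crossover_points f1 f0.
Proof.
suff sub (g h : R -> R) : crossover_points g h `<=` crossover_points h g.
  by apply/seteqP; split; exact: sub.
move=> x [gh [V Vx Vs]]; split=> //; exists V => // a b Va Vb.
by rewrite (Vs a b Va Vb) -[g a - h a]opprB -[g b - h b]opprB mulrNN.
Qed.

Section sign_change.
Context {R : realType} (f0 f1 : R -> R).
Hypotheses (cf0 : continuous f0) (cf1 : continuous f1)
  (fin : finite_set (coincidence_points f0 f1)).
Let h x := f0 x - f1 x.

Let ch : continuous h.
Proof. by move=> x; apply: cvgB; [exact: cf0|exact: cf1]. Qed.

Let h0 x : h x = 0 -> coincidence_points f0 f1 x.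
Proof. by move/eqP; rewrite subr_eq0 => /eqP. Qed.

(** Finite sets are closed, so the other coincidence points stay away from [c]. *)
Lemma coincidence_isolated c : exists2 e : R, 0 < e &
  forall x, `|c - x| < e -> x != c -> h x != 0.
Proof.
have : nbhs c (~` (coincidence_points f0 f1 `\ c)).
  apply: open_nbhs_nbhs; split; last by move=> [_ /=].
  apply/closed_openC.
  apply: ((@accessible_finite_set_closed R).1 _ _ (finite_setD _ fin)).
  exact/hausdorff_accessible/norm_hausdorff.
move=> /nbhs_ballP[e e0 ce]; exists e => // x cx xc; apply/eqP => hx.
by apply: (ce x) => //; split; [exact: h0|exact/eqP].
Qed.

(* The crossover is the supremum of the points of [a, b] where h < 0. *)
Lemma density_sign_change a b : a < b -> h a < 0 -> 0 < h b ->
  exists2 c, crossover_points f0 f1 c & a < c < b.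
Proof.
move=> ab ha hb.
pose S := [set x | x \in `[a, b] /\ h x < 0].
have Sa : S a by split=> //; rewrite in_itv/= lexx ltW.
have Sub : ubound S b by move=> x [+ _]; rewrite in_itv/= => /andP[].
have hS : has_sup S by split; [exists a|exists b].
pose c := sup S.
have ac : a <= c by exact: ub_le_sup hS.2 _ Sa.
have cb : c <= b by apply: ge_sup => //; exists a.
have posr x : c < x -> x <= b -> 0 <= h x.
  move=> cx xb; rewrite leNgt; apply/negP => hx.
  have : x <= c.
    apply: ub_le_sup => //; first by exists b.
    by split=> //; rewrite in_itv/= xb (le_trans ac (ltW cx)).
  by rewrite leNgt cx.
have hc_ge0 : 0 <= h c.
  have [->|] := eqVneq c b; first exact: ltW.
  rewrite neq_lt [b < c]ltNge cb orbF => {}cb.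
  rewrite leNgt; apply/negP => hc.
  have : \forall x \near c^'+, h x < 0.
    exact: cvgr_lt (cvg_at_right_filter (ch c)) _ hc.
  move=> near_neg; near c^'+ => x.
  suff : 0 <= h x by rewrite leNgt; apply/negP; rewrite negbK; near: x.
  by apply: posr; near: x; [exact: nbhs_right_gt|exact: nbhs_right_le].
have hc_le0 : h c <= 0.
  rewrite leNgt; apply/negP => hc.
  have /nbhs_ballP[e e0 ce] : \forall x \near c, 0 < h x.
    exact: cvgr_gt (ch c) _ hc.
  (* Points where [h < 0] come arbitrarily close to the supremum [c], against [0 < h] near [c]. *)
  have [x [xab hx] xc] := sup_adherent e0 hS.
  have xlec : x <= c by apply: (ub_le_sup hS.2).
  have : 0 < h x.
    by apply: ce; rewrite /ball/= ger0_norm ?subr_ge0// ltrBlDl -ltrBlDr.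
  by rewrite ltNge ltW.
have hc : h c = 0 by apply/eqP; rewrite eq_le hc_ge0 hc_le0.
have {}ac : a < c.
  by rewrite lt_neqAle ac andbT; apply/eqP => ac'; rewrite ac' hc ltxx in ha.
have {}cb : c < b.
  by rewrite lt_neqAle cb andbT; apply/eqP => cb'; rewrite -cb' hc ltxx in hb.
exists c; last by rewrite ac.
split; first exact: h0.
have [e e0 ce] := coincidence_isolated c.
(* Within distance [d] of [c], the only possible zero of [h] is [c], and points stay below [b], so
   that [posr] applies. *)
pose d := Num.min e (b - c).
have d0 : 0 < d by rewrite lt_min e0 subr_gt0.
have right_pos x : c < x -> `|c - x| < d -> 0 < h x.
  move=> cx; rewrite lt_min => /andP[xe].
  rewrite ltr0_norm ?subr_lt0// opprB ltrD2r => xb.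
  by rewrite lt_neqAle eq_sym ce ?gt_eqF// posr// ltW.
have left_neg x : x < c -> `|c - x| < d -> h x < 0.
  move=> xc; rewrite lt_min => /andP[xe _].
  rewrite ltNge; apply/negP => hx.
  have xcgt0 : 0 < c - x by rewrite subr_gt0.
  (* Some [s] between [x] and [c] has [h s < 0]; with [0 <= h x] this forces a zero in [[x, s]],
     which isolation of [c] forbids. *)
  have [s [sab hs]] := sup_adherent xcgt0 hS.
  rewrite opprB addrC subrK => xs.
  have sc : s < c.
    rewrite lt_neqAle [s <= c]ub_le_sup ?andbT//; last by exists b.
    by apply/eqP => sc; rewrite sc hc ltxx in hs.
  have [| |z] := @IVT _ h x s 0 (ltW xs).
  - exact: continuous_subspaceT.
  - by rewrite ge_min le_max hx (ltW hs) orbT.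
  rewrite in_itv/= => /andP[xz zs] /eqP; apply/negP/ce.
    rewrite gtr0_norm ?subr_gt0 ?(le_lt_trans zs)//.
    by rewrite (le_lt_trans _ xe)// gtr0_norm// lerD2l lerN2.
  by rewrite lt_eqF// (le_lt_trans zs).
exists (ball c d); first exact: nbhsx_ballx.
move=> x y cx cy; rewrite -[f0 x - f1 x]/(h x) -[f0 y - f1 y]/(h y).
(* [h z] and [z - c] have the same sign, zero included, so the two products in the crossover
   condition do too. *)
have sgh z : ball c d z -> Num.sg (h z) = Num.sg (z - c).
  rewrite /ball/= => cz; have [zc|zc|->] := ltgtP z c.
  - by rewrite (ltr0_sg (left_neg _ zc cz)) ltr0_sg ?subr_lt0.
  - by rewrite (gtr0_sg (right_pos _ zc cz)) gtr0_sg ?subr_gt0.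
  - by rewrite hc subrr.
by rewrite -sgr_gt0 -[in X in _ <-> X]sgr_gt0 !sgrM !sgh.
Unshelve. all: by end_near. Qed.

End sign_change.

(** A point of [I] with [f1 < f0] and one with [f0 < f1] would enclose a crossover point; which of
    them comes first decides the roles of the two densities. *)
Lemma between_crossovers {R : realType} (f0 f1 : R -> R) (I : set R) :
  continuous f0 -> continuous f1 -> finite_set (coincidence_points f0 f1) ->
  (forall x y z, I x -> I y -> crossover_points f0 f1 z -> ~ x < z < y) ->
  {in I, forall x, f0 x <= f1 x} \/ {in I, forall x, f1 x <= f0 x}.
Proof.
move=> cf0 cf1 fin IC.
have [?|/existsNP[x /not_implyP[/[!inE] Ix /negP]]] :=
  pselect (forall x, x \in I -> f0 x <= f1 x); first by left.
rewrite -ltNge => fx; right => y /[!inE] Iy; rewrite leNgt; apply/negP => fy.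
have finC : finite_set (coincidence_points f1 f0).
  by apply: sub_finite_set fin => z /=; exact: esym.
have [xy|yx|xy] := ltgtP x y.
- have [| |z] := @density_sign_change _ f1 f0 cf1 cf0 finC _ _ xy.
  + by rewrite subr_lt0.
  + by rewrite subr_gt0.
  by rewrite crossover_pointsC => ? ?; exact: (IC x y z).
- have [| |z] := @density_sign_change _ f0 f1 cf0 cf1 fin _ _ yx.
  + by rewrite subr_lt0.
  + by rewrite subr_gt0.
  by move=> ? ?; exact: (IC y x z).
- by move: fx; rewrite xy ltNge (ltW fy).
Qed.

(** * Strong law of large numbers for events *)

Lemma nat_sqrt_bracket n : exists k : nat, (k ^ 2 <= n < k.+1 ^ 2)%N.
Proof.
elim: n => [|n [k /andP[kn nk]]]; first by exists 0%N.
have [lt|le] := ltnP n.+1 (k.+1 ^ 2).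
  by exists k; rewrite lt (leq_trans kn).
by exists k.+1; rewrite le (leq_ltn_trans nk)// ltn_sqr.
Qed.

(* Two consecutive squares have ratio tending to 1, so a nondecreasing sequence
   is squeezed between its values at consecutive squares. *)
Lemma cvg_mean_of_squares {R : realType} (s : nat -> R) (p : R) :
  {homo s : m n / (m <= n)%N >-> m <= n} -> (forall n, 0 <= s n) ->
  s (k.+1 ^ 2)%N / (k.+1 ^ 2)%:R @[k --> \oo] --> p ->
  s n / n%:R @[n --> \oo] --> p.
Proof.
move=> s_nd s_ge0 s_p.
pose u k := s (k.+1 ^ 2)%N / (k.+1 ^ 2)%:R.
(* [v k = (k+1)/(k+2)] and [w k = (k+2)/(k+1)]; their squares exchange the denominators [(k+1)^2]
   and [(k+2)^2]. *)
pose v k := 1 - harmonic k.+1 : R.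
pose w k := 1 + harmonic k : R.
have harm1 : harmonic k.+1 @[k --> \oo] --> (0 : R).
  by rewrite (cvg_shiftS (@harmonic R)); exact: cvg_harmonic.
have v1 : v k @[k --> \oo] --> (1 : R).
  by rewrite -[X in _ --> X]subr0; apply: cvgB => //; exact: cvg_cst.
have w1 : w k @[k --> \oo] --> (1 : R).
  rewrite -[X in _ --> X]addr0; apply: cvgD; first exact: cvg_cst.
  exact: cvg_harmonic.
have low : u k * (v k * v k) @[k --> \oo] --> p.
  rewrite (_ : p = p * (1 * 1)); last by rewrite !mulr1.
  by apply: cvgM; [exact: s_p|exact: cvgM].
have up : u k.+1 * (w k * w k) @[k --> \oo] --> p.
  have us : u k.+1 @[k --> \oo] --> p by rewrite (cvg_shiftS u).
  rewrite (_ : p = p * (1 * 1)); last by rewrite !mulr1.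
  by apply: cvgM; [exact: us|exact: cvgM].
apply/cvgrPdist_lt => e e0.
move/cvgrPdist_lt : low => /(_ _ e0)[K _ low].
move/cvgrPdist_lt : up => /(_ _ e0)[L _ up].
(* With this threshold the square root bracket of [n] is some [k.+1] with [k] beyond both [K] and
   [L]. *)
exists ((maxn K L).+1 ^ 2)%N => // n /= KLn.
have [[|k] /andP[kn nk]] := nat_sqrt_bracket n.
  by move: (leq_ltn_trans KLn nk); rewrite ltn_sqr ltnS ltn0.
have KLk : (maxn K L <= k)%N.
  by move: (leq_ltn_trans KLn nk); rewrite ltn_sqr !ltnS.
have {}low := low k (leq_trans (leq_maxl _ _) KLk).
have {}up := up k (leq_trans (leq_maxr _ _) KLk).
have n0 : 0 < n%:R :> R by rewrite ltr0n (leq_trans _ kn)// expn_gt0.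
have lown : u k * (v k * v k) <= s n / n%:R.
  rewrite (_ : u k * _ = s (k.+1 ^ 2)%N / (k.+2 ^ 2)%:R); last first.
    rewrite /u /v /= !natrX -[k.+2%:R]natr1.
    have : 0 < k.+1%:R :> R by rewrite ltr0n.
    by move: k.+1%:R (s _) => a t a0; field; rewrite !gt_eqF//; lra.
  apply: ler_pM; rewrite ?invr_ge0//; first exact: s_nd.
  by rewrite lef_pV2 ?posrE// ?ltr0n ?expn_gt0// ler_nat ltnW.
have upn : s n / n%:R <= u k.+1 * (w k * w k).
  rewrite (_ : u k.+1 * _ = s (k.+2 ^ 2)%N / (k.+1 ^ 2)%:R); last first.
    rewrite /u /w /= !natrX -[k.+2%:R]natr1.
    have : 0 < k.+1%:R :> R by rewrite ltr0n.
    by move: k.+1%:R (s _) => a t a0; field; rewrite !gt_eqF//; lra.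
  apply: ler_pM; rewrite ?invr_ge0//; first by apply: s_nd; exact: ltnW.
  by rewrite lef_pV2 ?posrE// ?ltr0n ?expn_gt0// ler_nat.
rewrite ltr_distlC; rewrite ltr_distlC in low; rewrite ltr_distlC in up.
by lra.
Qed.

(** The sharper bound [2 - 1/n] is inductive, because [1/(x+1)^2 <= 1/x - 1/(x+1)]. *)
Lemma sum_inv_squares_le2 {R : realType} n :
  \sum_(k < n) ((k.+1 ^ 2)%:R : R)^-1 <= 2.
Proof.
suff H m : \sum_(k < m.+1) ((k.+1 ^ 2)%:R : R)^-1 <= 2 - m.+1%:R^-1.
  by case: n => [|n]; [rewrite big_ord0|rewrite (le_trans (H n)) ?gerBl].
elim: m => [|m IH]; first by rewrite big_ord_recr big_ord0/= exp1n invr1; lra.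
rewrite big_ord_recr /= natrX.
apply: (le_trans (lerD IH (lexx _))).
have m1 : 0 < m.+1%:R :> R by [].
rewrite -[m.+2%:R]natr1; move: m.+1%:R m1 => x x0.
suff : ((x + 1) ^+ 2)^-1 <= x^-1 - (x + 1)^-1. 
  move: (x^-1) ((x+1)^-1) (((x + 1) ^+ 2)^-1) => a b c; lra.
rewrite (_ : _ - _ = (x * (x + 1))^-1); last by field; lra.
rewrite lef_pV2 ?posrE; [nra|nra|nra].
Qed.

Section strong_law.
Context d (T : measurableType d) (R : realType) (P : probability T R).
Variables (A : nat -> set T) (p : R).
Hypotheses (mA : forall i, measurable (A i)) (PA : forall i, P (A i) = p%:E)
  (PAI : forall i j, i != j -> P (A i `&` A j) = (p * p)%:E).

Let S n w : R := \sum_(i < n) \1_(A i) w.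

Let S_ge0 n w : 0 <= S n w.
Proof. by apply: sumr_ge0. Qed.

Let mS n : measurable_fun setT (S n).
Proof. by apply: measurable_sum => i; exact: measurable_indic. Qed.

Let p_ge0 : 0 <= p.
Proof. by rewrite -lee_fin -(PA 0) measure_ge0. Qed.

Let integral_indicT (B : set T) :
  measurable B -> (\int[P]_w (\1_B w)%:E = P B)%E.
Proof. by move=> mB; rewrite integral_indic// setIT. Qed.

Let integral_count n : (\int[P]_w (S n w)%:E = (n%:R * p)%:E)%E.
Proof.
under eq_integral do rewrite /S -sumEFin.
rewrite ge0_integral_sum//; last first.
  by move=> i; apply/measurable_EFinP; exact: measurable_indic.
rewrite (eq_bigr (fun=> p%:E)) => [|i _].
  by rewrite sumEFin sumr_const card_ord mulr_natl.
by rewrite integral_indicT// PA.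
Qed.

(** The square is a double sum of indicators of intersections: [n] diagonal terms of mean [p] and
    [n (n - 1)] others of mean [p ^+ 2]. *)
Let integral_count_sq n :
  (\int[P]_w (S n w ^+ 2)%:E = (n%:R * p + n%:R * (n%:R - 1) * p ^+ 2)%:E)%E.
Proof.
have sqE w : (S n w ^+ 2)%:E =
    (\sum_(i < n) \sum_(j < n) (\1_(A i `&` A j) w)%:E)%E.
  rewrite expr2 /S big_distrlr/= -sumEFin; apply: eq_bigr => i _.
  by rewrite -sumEFin; apply: eq_bigr => j _; rewrite indicI.
under eq_integral do rewrite sqE.
have mI i j : measurable (A i `&` A j) by exact: measurableI.
rewrite ge0_integral_sum//; first last.
- by move=> i w _; apply: sume_ge0 => j _; rewrite lee_fin.
- move=> i; apply: emeasurable_sum => j.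
  by apply/measurable_EFinP; exact: measurable_indic.
rewrite (eq_bigr (fun=> (p + (n%:R - 1) * p ^+ 2)%:E)) => [|i _].
  by rewrite sumEFin sumr_const card_ord -[X in X%:E]mulr_natl mulrDr mulrA.
rewrite ge0_integral_sum//; last first.
  by move=> j; apply/measurable_EFinP; exact: measurable_indic.
rewrite (bigD1 i)//= integral_indicT// setIid PA.
rewrite (eq_bigr (fun=> (p * p)%:E)) => [|j ji].
  rewrite sumEFin sumr_const -EFinD cardC1 card_ord.
  congr (p + _)%:E; rewrite -[LHS]mulr_natl.
  by rewrite -subn1 natrB ?expr2// (leq_ltn_trans _ (ltn_ord i)).
by rewrite integral_indicT// PAI// eq_sym.
Qed.

(** The integral is the variance [n p (1 - p)]. *)
Let integral_deviation_sq n :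
  (\int[P]_w ((S n w - n%:R * p) ^+ 2)%:E <= (n%:R)%:E)%E.
Proof.
have mD : measurable_fun setT (fun w => (S n w - n%:R * p) ^+ 2).
  by apply: measurable_funX; apply: measurable_funB.
(* Only nonnegative functions appear in (S - np)^2 + 2np S = S^2 + (np)^2, so
   no integrability condition is needed. *)
have : (\int[P]_w ((S n w - n%:R * p) ^+ 2)%:E +
    \int[P]_w ((2 * n%:R * p)%:E * (S n w)%:E) =
    \int[P]_w (S n w ^+ 2)%:E + \int[P]_w ((n%:R * p) ^+ 2)%:E)%E.
  rewrite -!ge0_integralD//.
  - by apply: eq_integral => w _; rewrite -EFinM -!EFinD; congr EFin; ring.
  - by move=> w _; rewrite lee_fin sqr_ge0.
  - by apply/measurable_EFinP; exact: measurable_funX.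
  - by move=> w _; rewrite lee_fin sqr_ge0.
  - by move=> w _; rewrite lee_fin sqr_ge0.
  - exact/measurable_EFinP.
  - by move=> w _; rewrite -EFinM lee_fin !mulr_ge0.
  - by apply/measurable_EFinP; exact: measurable_funM.
rewrite ge0_integralZl_EFin//; first last.
- by rewrite !mulr_ge0.
- exact/measurable_EFinP.
- by move=> w _; rewrite lee_fin.
rewrite integral_count integral_count_sq integral_cst//= probability_setT mule1.
rewrite -EFinM -EFinD.
have p1 : p <= 1 by rewrite -lee_fin -(PA 0) probability_le1.
have n0 : 0 <= n%:R :> R by [].
(* The identity has a finite right-hand side, which excludes infinite values of the integral. *)
case: (integral _ _ _) => [r| |]//=; rewrite -EFinD => -[].
rewrite lee_fin => rE.
have -> : r = n%:R * p - n%:R * p ^+ 2 by lra.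
nra.
Qed.

Lemma strong_law_events :
  {ae P, forall w, (\sum_(i < n) \1_(A i) w) / n%:R @[n --> \oo] --> p}.
Proof.
pose Z k w := (S (k.+1 ^ 2) w / (k.+1 ^ 2)%:R - p) ^+ 2.
have mZ k : measurable_fun setT (Z k).
  apply: measurable_funX; apply: measurable_funB => //.
  exact: measurable_funM.
have Z_ge0 k w : (0 <= (Z k w)%:E)%E by rewrite lee_fin sqr_ge0.
have IZ k : (\int[P]_w (Z k w)%:E <= ((k.+1 ^ 2)%:R^-1 : R)%:E)%E.
  pose n := (k.+1 ^ 2)%N.
  have n0 : 0 < n%:R :> R by rewrite ltr0n expn_gt0.
  rewrite (_ : (\int[P]_w _ = (n%:R^-1 ^+ 2)%:E *
      \int[P]_w ((S n w - n%:R * p) ^+ 2)%:E)%E).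
    apply: (@le_trans _ _ ((n%:R^-1 ^+ 2)%:E * (n%:R)%:E)%E).
      rewrite lee_pmul2l// ?integral_deviation_sq//.
      by rewrite lte_fin exprn_gt0 ?invr_gt0.
    rewrite -EFinM lee_fin expr2 -mulrA mulVf ?mulr1// gt_eqF//.
  rewrite -ge0_integralZl_EFin//.
  - apply: eq_integral => w _; rewrite -EFinM /Z -/n; congr EFin.
    by rewrite -exprMn mulrBr mulrA mulVf ?gt_eqF// mul1r mulrC.
  - by move=> w _; rewrite lee_fin sqr_ge0.
  - by apply/measurable_EFinP/measurable_funX/measurable_funB.
have mZE k : measurable_fun setT (EFin \o Z k) by exact/measurable_EFinP.
(* The means of [Z k] are bounded by inverse squares, so the sum of all [Z k] has finite mean and is
   finite almost everywhere. *)
have intZ : P.-integrable setT (fun w => \sum_(0 <= k <oo) (Z k w)%:E)%E.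
  apply/integrableP; split.
    by apply: ge0_emeasurable_sum => k *; [exact: Z_ge0|exact: mZE].
  under eq_integral do rewrite gee0_abs ?nneseries_ge0//.
  rewrite integral_nneseries//.
  apply: (@le_lt_trans _ _ 2%:E); last exact: ltry.
  apply: lime_le.
    by apply: is_cvg_nneseries => k _ _; exact: integral_ge0.
  apply: nearW => n; rewrite big_mkord.
  apply: (@le_trans _ _ (\sum_(k < n) ((k.+1 ^ 2)%:R^-1 : R)%:E)%E).
    exact: lee_sum.
  by rewrite sumEFin lee_fin sum_inv_squares_le2.
apply: filterS (integrable_ae measurableT intZ) => w /(_ Logic.I) Zfin.
have tail : (\sum_(N <= k <oo) (Z k w)%:E)%E @[N --> \oo] --> 0%E.
  apply: nneseries_tail_cvg => //.
  by rewrite -ge0_fin_numE// nneseries_ge0.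
apply: (@cvg_mean_of_squares _ (fun n => S n w)) => //.
- by apply/nondecreasing_seqP => n; rewrite /S big_ord_recr/= lerDl.
- apply/cvgrPdist_lt => e e0.
  have : \forall N \near \oo, (\sum_(N <= k <oo) (Z k w)%:E < (e ^+ 2)%:E)%E.
    have /fine_cvgP[tail_fin /cvgr_lt /(_ (e ^+ 2))] := tail.
    rewrite exprn_gt0// => /(_ isT); apply: filterS2 tail_fin => N tail_fin.
    by rewrite -lte_fin fineK.
  apply: filterS => N; move=> tailN.
  (* A tail of a nonnegative series dominates its first term. *)
  have : (Z N w < e ^+ 2).
    rewrite -lte_fin (le_lt_trans _ tailN)//.
    have := @nneseries_lim_ge R (fun k => (Z k w)%:E) xpredT N N.+1.
    by rewrite big_nat1; exact.
  by rewrite /Z -real_normK ?num_real// ltr_pXn2r ?nnegrE// ?ltW// distrC.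
Qed.

End strong_law.

(** * Glivenko-Cantelli *)

Section uniform_cdf.
Context {R : realType} (F : R -> R).
Hypotheses (Fnd : {homo F : x y / x <= y}) (cF : continuous F)
  (Fy : F x @[x --> +oo] --> (1 : R)) (FNy : F x @[x --> -oo] --> (0 : R)).

Lemma cdf_surjective r : 0 < r < 1 -> exists t, F t = r.
Proof.
move=> /andP[r0 r1].
have [a Fa] : exists a, F a < r.
  exact: filter_ex (cvgr_lt _ FNy _ r0).
have [b Fb] : exists b, r < F b.
  exact: filter_ex (cvgr_gt _ Fy _ r1).
have ab : a <= b.
  rewrite leNgt; apply/negP => /ltW/Fnd.
  by rewrite leNgt (lt_trans Fa Fb).
have [| |t _] := @IVT _ F a b r ab; last by exists t.
  exact: continuous_subspaceT.
by rewrite ge_min le_max (ltW Fa) (ltW Fb) orbT.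
Qed.

Lemma cdf_ge0_le1 x : 0 <= F x <= 1.
Proof.
apply/andP; split; rewrite leNgt; apply/negP => Fx.
- have [y [/ltW/Fnd]] := filter_ex
    (filterI (nbhs_ninfty_lt (num_real x)) (cvgr_gt _ FNy _ Fx)).
  by rewrite leNgt => /negP.
- have [y [/ltW/Fnd]] := filter_ex
    (filterI (nbhs_pinfty_gt (num_real x)) (cvgr_lt _ Fy _ Fx)).
  by rewrite leNgt => /negP.
Qed.

(* Polya: the grid consists of the k-quantiles of F. *)
Lemma uniform_cdf_grid (e : R) : 0 < e -> exists s : seq R,
  forall G : R -> R, {homo G : x y / x <= y} -> (forall x, 0 <= G x <= 1) ->
  {in s, forall t, `|F t - G t| < e} -> forall x, `|F x - G x| < 2 * e.
Proof.
move=> e0.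
(* The upper estimate below loses two cells of width [1/k], hence the requirement [2/k < e]. *)
pose k := (Num.truncn (2 / e)).+1.
have k0 : 0 < k%:R :> R by rewrite ltr0n.
have ke : 2 / k%:R < e.
  by rewrite ltr_pdivrMr// mulrC -ltr_pdivrMr// truncnS_gt.
have [t tE] : exists t : nat -> R,
    forall j, (0 < j < k)%N -> F (t j) = j%:R / k%:R.
  suff /choice[t] : forall j, exists t : R, (0 < j < k)%N -> F t = j%:R / k%:R.
    by exists t.
  move=> j; have [/andP[j0 jk]|_] := boolP (0 < j < k)%N; last by exists 0.
  have [|t Ft] := @cdf_surjective (j%:R / k%:R); last by exists t.
  by rewrite divr_gt0 ?ltr0n//= ltr_pdivrMr// mul1r ltr_nat.
exists [seq t j | j <- iota 0 k] => G Gnd G01 Gt x.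
have {}Gt j : (0 < j < k)%N -> `|j%:R / k%:R - G (t j)| < e.
  move=> jk; rewrite -tE//; apply: Gt; apply: map_f.
  by rewrite mem_iota add0n; case/andP: jk.
have /andP[Fx0 Fx1] := cdf_ge0_le1 x.
have /andP[Gx0 Gx1] := G01 x.
pose j := Num.truncn (k%:R * F x).
have /andP[jF Fj] : j%:R <= k%:R * F x < j.+1%:R.
  by apply: truncn_itv; rewrite mulr_ge0// ltW.
have {}jF : j%:R / k%:R <= F x by rewrite ler_pdivrMr// mulrC.
have {}Fj : F x < j.+1%:R / k%:R by rewrite ltr_pdivlMr// mulrC.
have ik : 0 < k%:R^-1 :> R by rewrite invr_gt0.
have k1 : k%:R / k%:R = 1 :> R by rewrite divff// gt_eqF.
have cdf_lt y z : F y < F z -> y <= z.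
  by move=> yz; rewrite leNgt; apply/negP => /ltW/Fnd; rewrite leNgt yz.
rewrite ltr_norml; apply/andP; split.
(* The next quantile lies to the right of [x] and bounds [G x]; past the last quantile, [G x <= 1]
   takes its place. *)
- have [jk|kj] := ltnP j.+1 k.
    have := Gt j.+1 jk; rewrite ltr_distlC => /andP[_ Gtj].
    have xt : x <= t j.+1 by apply: cdf_lt; rewrite tE.
    have := Gnd _ _ xt; move: jF Fj Gtj; rewrite -natr1 mulrDl mul1r.
    by lra.
  have : k%:R / k%:R <= j.+1%:R / k%:R :> R by rewrite ler_pM2r// ler_nat.
  by move: jF Fj; rewrite k1 -natr1 mulrDl mul1r; lra.
(* As [F] may be flat, a quantile is known to lie left of [x] only if its level is strictly below
   [F x]; hence the step one level down. For the two lowest levels, [0 <= G x] suffices. *)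
- case: j jF Fj => [|[|j]] jF Fj.
  + by move: Fj; rewrite mul1r; lra.
  + by move: Fj; lra.
  have jk : (0 < j.+1 < k)%N.
    rewrite /= -(ltr_nat R) -(ltr_pM2r ik) k1 (lt_le_trans _ Fx1)//.
    by rewrite (lt_le_trans _ jF)// ltr_pM2r// ltr_nat.
  have := Gt j.+1 jk; rewrite ltr_distlC => /andP[Gtj _].
  have tx : t j.+1 <= x.
    by apply: cdf_lt; rewrite tE// (lt_le_trans _ jF)// ltr_pM2r// ltr_nat.
  have := Gnd _ _ tx; move: jF Fj Gtj.
  by rewrite -(@natr1 R j.+2) -(@natr1 R j.+1) !mulrDl !mul1r; lra.
Qed.

End uniform_cdf.

Lemma ecdf_ge0_le1 {R : realType} (x : nat -> R) m (r : R) :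
  0 <= ecdf x m r%:E <= 1.
Proof.
(* For [m = 0] the quotient is 0 by the convention for division by zero. *)
rewrite /= divr_ge0//=; case: m => [|m]; first by rewrite invr0 mulr0.
by rewrite ler_pdivrMr// mul1r ler_nat -[leqRHS]card_ord max_card.
Qed.

Lemma ecdf_nondecreasing {R : realType} (x : nat -> R) m :
  {homo (fun r : R => ecdf x m r%:E) : r s / r <= s}.
Proof.
move=> r s rs /=; rewrite ler_wpM2r ?invr_ge0// ler_nat.
by apply/subset_leq_card/fintype.subsetP => i; rewrite !inE => /le_trans; apply.
Qed.

Lemma ecdfE {R : realType} (x : nat -> R) m (r : R) :
  ecdf x m r%:E = (\sum_(i < m) (x i <= r)%R%:R) / m%:R.
Proof.
rewrite /= -sum1_card natr_sum big_mkcond/=; congr (_ / _).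
by apply: eq_bigr => i _; rewrite inE; case: ifP.
Qed.

Section glivenko_cantelli.
Context d (T : measurableType d) (R : realType) (P : probability T R).
Variables (X : nat -> {RV P >-> R}) (F : R -> R).
Hypotheses (cdfX : forall i r, cdf (X i) r = (F r)%:E) (cF : continuous F)
  (indepX : forall r i j, i != j ->
    P ((X i @^-1` `]-oo, r]) `&` (X j @^-1` `]-oo, r])) =
    (P (X i @^-1` `]-oo, r]) * P (X j @^-1` `]-oo, r]))%E).

Lemma real_cdf_nondecreasing : {homo F : x y / x <= y}.
Proof.
by move=> x y /(cdf_nondecreasing (X 0)); rewrite !cdfX lee_fin.
Qed.

Lemma real_cdf_cvgy : F x @[x --> +oo] --> (1 : R).
Proof.
have := cvg_cdfy1 (X 0); rewrite (_ : cdf _ = EFin \o F).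
  by move/fine_cvg.
by apply/funext => r; exact: cdfX.
Qed.

Lemma real_cdf_cvgNy : F x @[x --> -oo] --> (0 : R).
Proof.
have := cvg_cdfNy0 (X 0); rewrite (_ : cdf _ = EFin \o F).
  by move/fine_cvg.
by apply/funext => r; exact: cdfX.
Qed.

(** This is the strong law for the events [X i <= r]; the exceptional null set depends on [r]. *)
Lemma ecdf_cvg r :
  {ae P, forall w, ecdf (X^~ w) m r%:E @[m --> \oo] --> F r}.
Proof.
have PX i : P (X i @^-1` `]-oo, r]) = (F r)%:E by exact: cdfX.
have mX i : measurable (X i @^-1` `]-oo, r]).
  by rewrite -[X in measurable X]setTI; exact: measurable_funPT.
have PXI i j : i != j ->
    P ((X i @^-1` `]-oo, r]) `&` (X j @^-1` `]-oo, r])) = (F r * F r)%:E.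
  by move=> ij; rewrite indepX// !PX.
apply: filterS (strong_law_events _ _ _ P (fun i => X i @^-1` `]-oo, r]) (F r)
  mX PX PXI) => w.
suff -> : (fun m => ecdf (X^~ w) m r%:E) =
    (fun m => (\sum_(i < m) \1_(X i @^-1` `]-oo, r]) w) / m%:R) by [].
apply/funext => m.
rewrite ecdfE; congr (_ / _); apply: eq_bigr => i _.
rewrite indicE; congr (nat_of_bool _)%:R.
by apply/idP/idP; rewrite inE/= in_itv.
Qed.

Lemma glivenko_cantelli :
  {ae P, forall w, forall e : R, 0 < e -> \forall m \near \oo,
    forall t, `|ext_cdf F t - ecdf (X^~ w) m t| < e}.
Proof.
have step (e : R) : 0 < e -> {ae P, forall w, \forall m \near \oo,
    forall t, `|ext_cdf F t - ecdf (X^~ w) m t| < 2 * e}.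
  move=> e0.
  have [s sP] := uniform_cdf_grid F real_cdf_nondecreasing cF real_cdf_cvgy
    real_cdf_cvgNy e e0.
  (* Indexing the grid by all naturals, with default 0 past its end, needs only a countable union of
     null sets. *)
  have : {ae P, forall w, forall n,
      ecdf (X^~ w) m (s`_n)%:E @[m --> \oo] --> F s`_n}.
    by apply: ae_foralln => n; exact: ecdf_cvg.
  apply: filterS => w cvg_s.
  have : \forall m \near \oo,
      {in s, forall t, `|F t - ecdf (X^~ w) m t%:E| < e}.
    have cvg_in : {in s, forall t, ecdf (X^~ w) m t%:E @[m --> \oo] --> F t}.
      by move=> t /(nthP 0)[n _ <-].
    elim: (s) cvg_in => [|t u IH] cvg_in; first exact: nearW.
    have /IH : {in u, forall t, ecdf (X^~ w) m t%:E @[m --> \oo] --> F t}.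
      by move=> v vu; apply: cvg_in; rewrite in_cons vu orbT.
    have /cvgrPdist_lt/(_ _ e0) := cvg_in t (mem_head _ _).
    apply: filterS2 => m te ue v; rewrite in_cons => /predU1P[->//|].
    exact: ue.
  apply: filterS => m me [r| |] /=.
  - apply: (sP (fun r => ecdf (X^~ w) m r%:E)) => //.
    + exact: ecdf_nondecreasing.
    + by move=> x; exact: ecdf_ge0_le1.
  - by rewrite subrr normr0 mulr_gt0.
  - by rewrite subrr normr0 mulr_gt0.
(* Countably many tolerances [2/(n+1)] make the null set independent of [e]. *)
have : {ae P, forall w, forall n, \forall m \near \oo,
    forall t, `|ext_cdf F t - ecdf (X^~ w) m t| < 2 * n.+1%:R^-1}.
  by apply: ae_foralln => n; exact: step.
apply: filterS => w GC e e0.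
have /cvgrPdist_lt/(_ (e / 2)) := @cvg_harmonic R.
rewrite divr_gt0// => /(_ isT)[n _ /(_ n (leqnn _))] /=.
rewrite sub0r normrN gtr0_norm ?invr_gt0// => ne.
apply: filterS (GC n) => m me t.
by rewrite (lt_trans (me t))// mulrC -ltr_pdivlMr.
Qed.

End glivenko_cantelli.

(** * Measurability *)

Lemma cutpoint_tnth {R : realType} q (v : q.-tuple R) (i : 'I_q) :
  cutpoint v i.+1 = (tnth v i)%:E.
Proof.
by rewrite /cutpoint/= (nth_map (tnth_default v i)) ?size_tuple// -tnth_nth.
Qed.

Lemma cutpoint_overflow {R : realType} q (v : q.-tuple R) i :
  (q <= i)%N -> cutpoint v i.+1 = +oo%E.
Proof. by move=> qi; rewrite /cutpoint/= nth_default// size_map size_tuple. Qed.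

Lemma eq_empirical_overlap {R : realType} (x y : nat -> R) m n q
    (u v : q.-tuple R) :
  (forall i, ecdf x m (tnth u i)%:E = ecdf x m (tnth v i)%:E /\
             ecdf y n (tnth u i)%:E = ecdf y n (tnth v i)%:E) ->
  empirical_overlap x y m n u = empirical_overlap x y m n v.
Proof.
move=> uv.
have cut i : ecdf x m (cutpoint u i) = ecdf x m (cutpoint v i) /\
             ecdf y n (cutpoint u i) = ecdf y n (cutpoint v i).
  case: i => [//|i].
  have [iq|qi] := ltnP i q; last by rewrite !cutpoint_overflow.
  by have := uv (Ordinal iq); rewrite -!cutpoint_tnth.
rewrite /empirical_overlap; apply: eq_bigr => i _.
by have [-> ->] := cut i; have [-> ->] := cut i.+1.
Qed.

Definition lattice_point {R : realType} (k : nat) (z : int) : R :=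
  z%:~R / k.+1%:R.

(** This is the least lattice index strictly above [r]; it is monotone in [r], so sorted tuples stay
    sorted. *)
Definition lattice_above {R : realType} (k : nat) (r : R) : int :=
  Num.floor (k.+1%:R * r) + 1.

Lemma lattice_above_itv {R : realType} k (r : R) :
  r < lattice_point k (lattice_above k r) <= r + k.+1%:R^-1.
Proof.
have k0 : 0 < k.+1%:R :> R by rewrite ltr0n.
rewrite /lattice_point /lattice_above.
have /andP[lo up] := floor_itv (k.+1%:R * r).
rewrite ltr_pdivlMr// ler_pdivrMr// mulrDl mulVf ?gt_eqF//.
by rewrite [r * _]mulrC up/= intrD lerD2r.
Qed.

(** Samples at most [r] stay counted; each of the finitely many samples beyond [r] exceeds the
    lattice point once [1/(k+1)] is less than its distance to [r]. *)
Lemma ecdf_lattice_above {R : realType} (x : nat -> R) m (r : R) :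
  \forall k \near \oo,
    ecdf x m (lattice_point k (lattice_above k r))%:E = ecdf x m r%:E.
Proof.
have near_i (i : 'I_m) : \forall k \near \oo,
    (x i <= lattice_point k (lattice_above k r)) = (x i <= r).
  have [xr|rx] := leP (x i) r.
    apply: nearW => k; apply: (le_trans xr).
    by have /andP[/ltW] := lattice_above_itv k r.
  have xr0 : 0 < x i - r by rewrite subr_gt0.
  have /cvgrPdist_lt/(_ _ xr0) := @cvg_harmonic R.
  apply: filterS => k.
  rewrite sub0r normrN gtr0_norm ?invr_gt0//= ltrBrDl => kx.
  have /andP[_ zk] := lattice_above_itv k r.
  by apply/negbTE; rewrite -ltNge (le_lt_trans zk).
apply: filterS (filter_forall _ near_i) => k xk; rewrite !ecdfE; congr (_ / _).
by apply: eq_bigr => i _; rewrite xk.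
Qed.

Definition lattice_tuple {R : realType} {q} k (z : q.-tuple int) : q.-tuple R :=
  [tuple of map (lattice_point k) z].

(* By right continuity of the empirical distribution functions, moving each
   cut point slightly to the right does not change the overlap. *)
Lemma min_overlap_lattice {R : realType} (x y : nat -> R) q m n a :
  min_overlap x y q m n < a <->
  exists k (z : q.-tuple int), @nondecreasing_tuples R q (lattice_tuple k z) /\
    empirical_overlap x y m n (lattice_tuple k z) < a.
Proof.
have [[v v_sorted vE] vmin] := min_overlap_attained x y q m n.
split; last by move=> [k [z [z_sorted]]]; apply: le_lt_trans; exact: vmin.
rewrite -vE => va.
have : \forall k \near \oo, forall i : 'I_q,
    ecdf x m (lattice_point k (lattice_above k (tnth v i)))%:E =
      ecdf x m (tnth v i)%:E /\
    ecdf y n (lattice_point k (lattice_above k (tnth v i)))%:E =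
      ecdf y n (tnth v i)%:E.
  apply: filter_forall => i.
  by apply: filterI; exact: ecdf_lattice_above.
move=> /filter_ex[k kE]; exists k, [tuple of map (lattice_above k) v].
have zE i : tnth (lattice_tuple k [tuple of map (lattice_above k) v]) i =
    lattice_point k (lattice_above k (tnth v i)) :> R.
  by rewrite !tnth_map.
split; last first.
  by rewrite (@eq_empirical_overlap _ _ _ _ _ _ _ v)// => i; rewrite zE.
rewrite /nondecreasing_tuples/= -map_comp.
apply: homo_sorted v_sorted => r s rs /=.
rewrite ler_wpM2r ?invr_ge0// ler_int lerD2r.
by apply: le_floor; rewrite ler_wpM2l.
Qed.

Section measurable_overlap.
Context d (T : measurableType d) (R : realType) (P : probability T R).
Variables X Y : nat -> {RV P >-> R}.

Lemma measurable_ecdf (Z : nat -> {RV P >-> R}) m (t : \bar R) :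
  measurable_fun setT (fun w => ecdf (Z^~ w) m t).
Proof.
case: t => [r| |]; [|exact: measurable_cst|exact: measurable_cst].
under eq_fun do rewrite ecdfE.
apply: measurable_funM => //; apply: measurable_sum => i.
rewrite (_ : (fun w => _) = \1_(Z i @^-1` `]-oo, r])).
  apply: measurable_indic.
  by rewrite -[X in measurable X]setTI; exact: measurable_funPT.
apply/funext => w; rewrite indicE; congr (nat_of_bool _)%:R.
by apply/idP/idP; rewrite inE/= in_itv.
Qed.

Lemma measurable_empirical_overlap m n q (v : q.-tuple R) :
  measurable_fun setT
    (fun w => empirical_overlap (X^~ w) (Y^~ w) m n v).
Proof.
apply: measurable_sum => i; apply: measurable_minr;
  by apply: measurable_funB; exact: measurable_ecdf.
Qed.

(** Restricting the cut points to lattices writes the event that the minimum is below [a] as a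
    countable union of measurable events. *)
Lemma measurable_min_overlap m n q :
  measurable_fun setT (fun w => min_overlap (X^~ w) (Y^~ w) q m n).
Proof.
apply: (measurability _ (RGenInftyO.measurableE R)).
move=> _ [_ [a ->] <-]; rewrite setTI.
rewrite (_ : _ @^-1` _ = \bigcup_k \bigcup_(z : q.-tuple int)
    ([set _ | @nondecreasing_tuples R q (lattice_tuple k z)] `&`
     [set w | empirical_overlap (X^~ w) (Y^~ w) m n (lattice_tuple k z) < a])).
  apply: bigcupT_measurable => k; apply: countable_bigcupT_measurable => // z.
  apply: measurableI.
    (* Sortedness does not involve the sample point, so this set is full or empty. *)
    have [vs|nvs] := pselect (@nondecreasing_tuples R q (lattice_tuple k z)).
      by rewrite (_ : mkset _ = setT)//; apply/seteqP; split.
    by rewrite (_ : mkset _ = set0)//; apply/seteqP; split.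
  rewrite (_ : mkset _ =
      (fun w => empirical_overlap (X^~ w) (Y^~ w) m n (lattice_tuple k z))
        @^-1` `]-oo, a[); last first.
    by apply/seteqP; split=> w /=; rewrite in_itv.
  rewrite -[X in measurable X]setTI.
  exact: measurable_empirical_overlap.
apply/seteqP; split=> w /=.
- rewrite in_itv/= => /min_overlap_lattice[k [z [zs za]]].
  by exists k => //; exists z.
- move=> [k _ [z _ [/= zs za]]]; rewrite in_itv/=.
  by apply/min_overlap_lattice; exists k, z.
Qed.

End measurable_overlap.

(** Tolerances [1/(k+1)] and a common threshold [M] for both indices express the double limit by
    countable operations. *)
Lemma measurable_cvg_prod_nat d (T : measurableType d) (R : realType)
    (g : nat -> nat -> T -> R) (l : R) :
  (forall m n, measurable_fun setT (g m n)) ->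
  measurable [set w | (fun mn : nat * nat => g mn.1 mn.2 w)
                        @ filter_prod \oo \oo --> l].
Proof.
move=> mg.
rewrite (_ : mkset _ = \bigcap_k \bigcup_M \bigcap_m \bigcap_n
    (g (M + m)%N (M + n)%N @^-1` ball l k.+1%:R^-1)).
  apply: bigcapT_measurable => k; apply: bigcupT_measurable => M.
  apply: bigcapT_measurable => m; apply: bigcapT_measurable => n.
  rewrite -[X in measurable X]setTI; apply: mg => //.
  exact: measurable_ball.
apply/seteqP; split=> w /=.
- move=> /cvgrPdist_lt gl k _.
  have /gl[[A B] [/= [a _ aA] [b _ bB]] AB] : 0 < k.+1%:R^-1 :> R by [].
  exists (maxn a b) => // m _ n _ /=.
  apply: (AB (_, _)); split=> /=; [apply: aA|apply: bB] => /=.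
    by rewrite (leq_trans (leq_maxl a b)) ?leq_addr.
  by rewrite (leq_trans (leq_maxr a b)) ?leq_addr.
- move=> gl; apply/cvgrPdist_lt => e e0.
  have /cvgrPdist_lt/(_ _ e0)[k _ /(_ k (leqnn _))] := @cvg_harmonic R.
  rewrite /= sub0r normrN gtr0_norm ?invr_gt0// => ke.
  have [M _ MP] := gl k Logic.I.
  exists ([set m | (M <= m)%N], [set n | (M <= n)%N]).
    by split; exists M.
  move=> [m n] [/= Mm Mn].
  have := MP (m - M)%N Logic.I (n - M)%N Logic.I.
  by rewrite /= !subnKC// => /lt_trans; exact.
Qed.

(** * Overlap at given cut points *)

Lemma cutpoint_le {R : realType} q (v : q.-tuple R) i j :
  nondecreasing_tuples v -> (i <= j)%N -> (cutpoint v i <= cutpoint v j)%E.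
Proof.
move=> vs; case: i => [|i]; first by rewrite /cutpoint/= leNye.
case: j => [//|j]; rewrite ltnS => ij.
have [jq|qj] := ltnP j q; last by rewrite [leRHS]cutpoint_overflow// leey.
have iq := leq_ltn_trans ij jq.
rewrite (cutpoint_tnth _ v (Ordinal jq)) (cutpoint_tnth _ v (Ordinal iq)).
rewrite lee_fin !(tnth_nth 0)/=.
apply: (sorted_leq_nth le_trans lexx) => //;
  by rewrite inE size_tuple.
Qed.

(** Each difference moves by less than [2 * e], and the minimum is 1-Lipschitz for the sup norm. *)
Lemma ler_distB_min {R : realType} (e a b c d a' b' c' d' : R) :
  `|a - a'| < e -> `|b - b'| < e -> `|c - c'| < e -> `|d - d'| < e ->
  `|Num.min (a - b) (c - d) - Num.min (a' - b') (c' - d')| <= 2 * e.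
Proof.
rewrite !ltr_norml => /andP[? ?] /andP[? ?] /andP[? ?] /andP[? ?].
rewrite ler_norml.
by case: (leP (a - b)); case: (leP (a' - b')) => *; apply/andP; split; lra.
Qed.

Definition overlap {R : realType} (F0 F1 : R -> R) {q} (v : q.-tuple R) : R :=
  \sum_(i < q.+1)
    Num.min (ext_cdf F0 (cutpoint v i.+1) - ext_cdf F0 (cutpoint v i))
            (ext_cdf F1 (cutpoint v i.+1) - ext_cdf F1 (cutpoint v i)).

Lemma overlap_empirical_dist {R : realType} (F0 F1 : R -> R) (x y : nat -> R)
    m n q (v : q.-tuple R) (e : R) :
  (forall t, `|ext_cdf F0 t - ecdf x m t| < e) ->
  (forall t, `|ext_cdf F1 t - ecdf y n t| < e) ->
  `|overlap F0 F1 v - empirical_overlap x y m n v| <= q.+1%:R * (2 * e).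
Proof.
move=> xe ye; rewrite /overlap /empirical_overlap -sumrB.
rewrite (le_trans (ler_norm_sum _ _ _))// mulr_natl -[in leRHS](card_ord q.+1).
by rewrite -sumr_const; apply: ler_sum => i _; exact: ler_distB_min.
Qed.

Section increments.
Context {R : realType}.
Local Notation mu := (@lebesgue_measure R).
Implicit Types (g h : R -> R) (s t : \bar R).

(** An indefinite integral from [-oo]: integrals over cells become increments, which telescope. *)
Definition Rintegral_below g t : R := \int[mu]_(x in lower_set t) g x.

Lemma Rintegral_belowB g s t : (s <= t)%E -> mu.-integrable setT (EFin \o g) ->
  Rintegral_below g t - Rintegral_below g s =
  \int[mu]_(x in lower_set t `\` lower_set s) g x.
Proof.
move=> st ig; rewrite /Rintegral_below.
rewrite -[in X in X - _](setDUK (subset_lower_set _ _ st)).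
rewrite Rintegral_setU; first by rewrite addrC addKr.
- exact: measurable_lower_set.
- by apply: measurableD; exact: measurable_lower_set.
- apply: integrableS ig => //.
  by apply: measurableU; [|apply: measurableD]; exact: measurable_lower_set.
- by rewrite disj_set2E setDIK.
Qed.

Lemma le_Rintegral_belowB g h s t : (s <= t)%E ->
  mu.-integrable setT (EFin \o g) -> mu.-integrable setT (EFin \o h) ->
  (forall x, (s < x%:E <= t)%E -> g x <= h x) ->
  Rintegral_below g t - Rintegral_below g s <=
  Rintegral_below h t - Rintegral_below h s.
Proof.
move=> st ig ih gh; rewrite !Rintegral_belowB//.
have mD : measurable (lower_set t `\` lower_set s).
  by apply: measurableD; exact: measurable_lower_set.
apply: le_Rintegral => //.
- exact: integrableS ig.
- exact: integrableS ih.
- move=> x [xt /negP]; rewrite /lower_set/= -ltNge => sx; apply: gh.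
  by rewrite sx.
Qed.

(** The sum telescopes from [-oo], where the set is empty, to [+oo], where it is the whole line. *)
Lemma sum_Rintegral_belowB g q (v : q.-tuple R) :
  \sum_(i < q.+1) (Rintegral_below g (cutpoint v i.+1) -
                   Rintegral_below g (cutpoint v i)) = \int[mu]_x g x.
Proof.
rewrite -(big_mkord xpredT (fun i => Rintegral_below g (cutpoint v i.+1) -
                   Rintegral_below g (cutpoint v i))).
rewrite telescope_sumr// cutpoint_overflow// /Rintegral_below lower_sety.
by rewrite /cutpoint/= lower_setNy Rintegral_set0 subr0.
Qed.

End increments.

Section overlap_densities.
Context {R : realType} (F0 F1 f0 f1 : R -> R).
Hypotheses (if0 : lebesgue_measure.-integrable setT (EFin \o f0))
  (if1 : lebesgue_measure.-integrable setT (EFin \o f1))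
  (F0E : forall t, Rintegral_below f0 t = ext_cdf F0 t)
  (F1E : forall t, Rintegral_below f1 t = ext_cdf F1 t).

Let g x := Num.min (f0 x) (f1 x).

(** The minimum is dominated by the sum of the absolute values. *)
Let ig : lebesgue_measure.-integrable setT (EFin \o g).
Proof.
have mf (f : R -> R) : lebesgue_measure.-integrable setT (EFin \o f) ->
    measurable_fun setT f.
  by move=> /measurable_int/measurable_EFinP.
have iabs :=
  integrableD measurableT (integrable_abse if0) (integrable_abse if1).
apply: (le_integrable measurableT _ _ iabs).
  by apply/measurable_EFinP; apply: measurable_minr; exact: mf.
move=> x _ /=; rewrite lee_fin (ger0_norm (addr_ge0 _ _))// /g.
by case: (leP (f0 x) (f1 x)) => _; rewrite ?lerDl ?lerDr.
Qed.

Lemma integral_min_le_overlap q (v : q.-tuple R) : nondecreasing_tuples v ->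
  \int[lebesgue_measure]_x g x <= overlap F0 F1 v.
Proof.
move=> vs; rewrite -(sum_Rintegral_belowB g q v); apply: ler_sum => i _.
have ci : (cutpoint v i <= cutpoint v i.+1)%E by apply: cutpoint_le.
rewrite -!F0E -!F1E le_min !le_Rintegral_belowB// => x _.
- by rewrite ge_min lexx orbT.
- by rewrite ge_min lexx.
Qed.

Hypotheses (cf0 : continuous f0) (cf1 : continuous f1)
  (fin : finite_set (coincidence_points f0 f1)).

Lemma overlap_crossover_points q (v : q.-tuple R) : nondecreasing_tuples v ->
  [set` v] = crossover_points f0 f1 ->
  overlap F0 F1 v = \int[lebesgue_measure]_x g x.
Proof.
move=> vs vC; apply/eqP; rewrite eq_le integral_min_le_overlap// andbT.
rewrite -(sum_Rintegral_belowB g q v); apply: ler_sum => i _.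
have ci : (cutpoint v i <= cutpoint v i.+1)%E by apply: cutpoint_le.
pose I := [set x : R | (cutpoint v i < x%:E <= cutpoint v i.+1)%E].
have [|f01|f10] := @between_crossovers R f0 f1 I cf0 cf1 fin.
- move=> x y z /= /andP[ix _] /andP[_ yi] Cz /andP[xz zy].
  have /tnthP[j zE] : z \in v by move: Cz; rewrite -vC.
  (* Entry [j] of [v] is the cut point of index [j.+1], so it is at most the left end of cell [i] or
     at least its right end. *)
  have [ji|ij] := ltnP j i.
    have := cutpoint_le _ v _ _ vs ji.
    by rewrite cutpoint_tnth -zE leNgt (lt_trans ix)// lte_fin.
  have := cutpoint_le _ v i.+1 j.+1 vs ij.
  by rewrite cutpoint_tnth -zE leNgt (lt_le_trans _ yi)// lte_fin.
- rewrite ge_min; apply/orP; left; rewrite -!F0E le_Rintegral_belowB// => x Ix.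
  by rewrite le_min lexx f01// inE.
- rewrite ge_min; apply/orP; right; rewrite -!F1E le_Rintegral_belowB// => x Ix.
  by rewrite le_min lexx f10// inE.
Qed.

End overlap_densities.

(** * Almost sure convergence *)

Lemma crossover_tuple {R : realType} (f0 f1 : R -> R) N :
  (crossover_points f0 f1 #= `I_N)%card ->
  exists2 v : N.-tuple R, nondecreasing_tuples v &
    [set` v] = crossover_points f0 f1.
Proof.
move=> CN; have finC : finite_set (crossover_points f0 f1) by exists N.
pose s := sort <=%R (enum_fset (fset_set (crossover_points f0 f1))).
have sN : size s == N by rewrite size_sort; apply/eqP; exact: card_fset_set.
exists (Tuple sN); first exact: sort_sorted le_total _.
by rewrite -[RHS]fset_setK//; apply/seteqP; split=> x /=; rewrite mem_sort.
Qed.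

(** Mutual independence is specialized to the index set [{i, j}], whose product has two factors
    because [i != j]. *)
Lemma independent_rays d (T : measurableType d) (R : realType)
    (P : probability T R) (I : choiceType) (Z : I -> {RV P >-> R}) r i j :
  mutually_independent Z -> i != j ->
  P ((Z i @^-1` `]-oo, r]) `&` (Z j @^-1` `]-oo, r])) =
  (P (Z i @^-1` `]-oo, r]) * P (Z j @^-1` `]-oo, r]))%E.
Proof.
move=> indep ij.
have := indep [fset i; j]%fset (fun=> `]-oo, r]%classic)
  (fun=> measurable_itv _).
rewrite big_fsetU1 ?inE//= big_seq_fset1 => <-; congr (P _).
rewrite (_ : [set` _] = [set i; j]); first by rewrite bigcap_setU !bigcap_set1.
apply/seteqP; split=> k /=; rewrite !inE.
  by move=> /orP[] /eqP ->; [left|right].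
by move=> [] ->; rewrite eqxx ?orbT.
Qed.

Section density_of_random_variables.
Context d (T : measurableType d) (R : realType) (P : probability T R).
Variables (X : nat -> {RV P >-> R}) (F f : R -> R).
Hypotheses (cdfX : forall i r, cdf (X i) r = (F r)%:E)
  (dF : forall x : R, is_derive x (1 : R) F (f x)) (cf : continuous f).

Lemma integrable_rv_density : lebesgue_measure.-integrable setT (EFin \o f).
Proof.
exact: (@integrable_density R F f (real_cdf_nondecreasing _ _ _ _ _ _ cdfX)
  (real_cdf_cvgy _ _ _ _ _ _ cdfX) (real_cdf_cvgNy _ _ _ _ _ _ cdfX) dF cf).
Qed.

Lemma Rintegral_below_rv_density t : Rintegral_below f t = ext_cdf F t.
Proof.
rewrite /Rintegral_below /Rintegral.
by rewrite (@integral_density_lower_set R F f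
  (real_cdf_nondecreasing _ _ _ _ _ _ cdfX)
  (real_cdf_cvgy _ _ _ _ _ _ cdfX) (real_cdf_cvgNy _ _ _ _ _ _ cdfX) dF cf).
Qed.

End density_of_random_variables.

Theorem theorem2p6 (d : measure_display) (T : measurableType d) (R : realType)
    (P : probability T R) (X Y : nat -> {RV P >-> R})
    (F0 F1 f0 f1 : R -> R) (N : nat)
    (indep : mutually_independent (joint_family X Y))
    (cdfX : forall i r, cdf (X i) r = (F0 r)%:E)
    (cdfY : forall i r, cdf (Y i) r = (F1 r)%:E)
    (dF0 : forall x : R, is_derive x (1 : R) F0 (f0 x))
    (dF1 : forall x : R, is_derive x (1 : R) F1 (f1 x))
    (cf0 : continuous f0) (cf1 : continuous f1)
    (finC' : finite_set (coincidence_points f0 f1))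
    (cardC : (crossover_points f0 f1 #= `I_N)%card) :
  let rho : R := \int[lebesgue_measure]_x Num.min (f0 x) (f1 x) in
  let E : set T :=
    [set w | (fun mn : nat * nat =>
                min_overlap (fun i => X i w) (fun j => Y j w) N mn.1 mn.2)
             @ filter_prod \oo \oo --> rho] in
  measurable E /\ P E = 1%E.
Proof.
move=> rho E.
have mE : measurable E.
  exact: (@measurable_cvg_prod_nat _ _ _ (fun m n w =>
    min_overlap (X^~ w) (Y^~ w) N m n) rho
    (fun m n => measurable_min_overlap _ _ _ _ _ _ _ _ _)).
split=> //.
have if0 := integrable_rv_density _ _ _ _ X F0 f0 cdfX dF0 cf0.
have if1 := integrable_rv_density _ _ _ _ Y F1 f1 cdfY dF1 cf1.
have F0E := Rintegral_below_rv_density _ _ _ _ X F0 f0 cdfX dF0 cf0.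
have F1E := Rintegral_below_rv_density _ _ _ _ Y F1 f1 cdfY dF1 cf1.
(* Each sequence inherits pairwise independence from the joint family through [inl] or [inr]. *)
have GX := glivenko_cantelli _ _ _ _ X F0 cdfX
  (@continuous_cdf _ _ _ dF0) (fun r i j (ij : i != j) =>
    @independent_rays _ _ _ _ _ _ r (inl i) (inl j) indep ij).
have GY := glivenko_cantelli _ _ _ _ Y F1 cdfY
  (@continuous_cdf _ _ _ dF1) (fun r i j (ij : i != j) =>
    @independent_rays _ _ _ _ _ _ r (inr i) (inr j) indep ij).
have aeE : {ae P, forall w, E w}.
  apply: filterS2 GX GY => w Xw Yw; apply/cvgrPdist_lt => e e0.
  (* Each of the [N.+1] cells costs [2 * e'], for a total of [e / 2]. *)
  pose e' := e / (4 * N.+1%:R).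
  have e'0 : 0 < e' by rewrite divr_gt0// mulr_gt0// ltr0n.
  have ee' : N.+1%:R * (2 * e') < e.
    have N0 : 0 < N.+1%:R :> R by rewrite ltr0n.
    rewrite (_ : _ * _ = e / 2); first by rewrite ltr_pdivrMr//; lra.
    by rewrite /e'; field; rewrite nat1r gt_eqF.
  exists ([set m | forall t, `|ext_cdf F0 t - ecdf (X^~ w) m t| < e'],
          [set n | forall t, `|ext_cdf F1 t - ecdf (Y^~ w) n t| < e']).
    by split; [exact: Xw|exact: Yw].
  move=> [m n] [/= Xm Yn].
  have dist v := le_lt_trans
    (@overlap_empirical_dist _ F0 F1 _ _ _ _ N v _ Xm Yn) ee'.
  have [[v vs vE] vmin] := min_overlap_attained (X^~ w) (Y^~ w) N m n.
  have [c cs cC] := crossover_tuple f0 f1 N cardC.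
  have rho_le : rho <= overlap F0 F1 v by exact: integral_min_le_overlap.
  have rho_eq : overlap F0 F1 c = rho by exact: overlap_crossover_points.
  (* With minimizer [v] and crossover tuple [c], the minimum is above [rho - e] since
     [rho <= overlap F0 F1 v], and below [rho + e] since it is at most the empirical overlap at
     [c]. *)
  have le_c := vmin c cs.
  have := dist v; have := dist c; rewrite rho_eq vE !ltr_norml.
  by move=> /andP[c1 c2] /andP[v1 v2]; apply/andP; split; lra.
have PE0 : P (~` E) = 0%E.
  by apply/negligibleP; [exact: measurableC|exact: aeE].
by rewrite -[E]setCK probability_setC ?PE0 ?sube0//; exact: measurableC.
Qed.
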